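(* Let $G$ be a directed graph with $n$ nodes and $m$ edges, let $\ell\in\mathbb N$ and $\phi\in(0,1]$. Algorithm $\mathsf{EdgeSampling}(\overrightarrow{\mathcal{O}},\ell,\phi)$ run on $G$ has query complexity at most $\min\{2(2n+\ell)/\phi,\ m\}$ and outputs an estimate $\hat n\le n$. Furthermore, if $G$ has general conductance $\phi_\varepsilon(G)\ge\phi$, then the algorithm's output satisfies $\hat n\ge(1-\varepsilon)n$ with probability at least $1-2^{-\ell}$.
   Context: Oracle $\overrightarrow{\mathcal{O}}$: graph stored with out-adjacency lists in arbitrary order; nodes reported via an injective labelling; on $\mathsf{init}$ it returns an arbitrary node $v$ with $\deg^+(v)$; on $(u,i,\mathsf{out})$ for an already revealed node $u$ and $i\le\deg^+(u)$ it returns the $i$-th out-neighbour of $u$ with its out-degree. Each query costs one unit. General conductance: for $\emptyset\ne S\subsetneq V$, $\deg^+(S)=|\{(u,v)\in E:u\in S\}|$, $\partial S=\{(u,v)\in E:u\in S,v\notin S\}$, $\phi(S)=|\partial S|/\deg^+(S)$; for $\varepsilon>0$, $\phi_\varepsilon(G)=\min\{\phi(S): S\subseteq V,\ 1\le|S|\le(1-\varepsilon)|V|\}$. Algorithm $\mathsf{EdgeSampling}(\overrightarrow{\mathcal{O}},\ell,\phi)$: set counter $Y=0$; query $\mathsf{init}$ to get node $v$; $S=\{v\}$; $E'=\{(v,i): i\le\deg^+(v)\}$ (undisclosed out-edge slots). While $Y\le\ell$: run a block of up to $2/\phi$ steps; in each step pick $(u,i)$ uniformly at random from $E'$, query $(u,i,\mathsf{out})$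 obtaining $w$, and remove $(u,i)$ from $E'$; if $w\notin S$, add $w$ to $S$, add $\{(w,i):i\le\deg^+(w)\}$ to $E'$, and end the block. After the block, if a new node was found set $Y\leftarrow Y-1$, otherwise $Y\leftarrow Y+1$. When the loop ends, output $\hat n=|S|$.
   Formalization: The bound m counts only the (u,i,out) queries, since with init counted it fails (one node, no edges); the bound 2(2n+ℓ)/φ is proved for all queries. φ(S) is taken as 0 when deg⁺(S)=0, and a block also ends when E' is empty. *)

(* Defs.v *)
From HB Require Import structures.
From mathcomp Require Import all_boot all_order all_algebra.
From mathcomp Require Import finmap reals.

Set Implicit Arguments.
Unset Strict Implicit.
Unset Printing Implicit Defensive.

Import Order.TTheory GRing.Theory Num.Theory.
Local Open Scope fset_scope.
Local Open Scope ring_scope.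

(* Finitely supported probability distributions, as weighted lists of outcomes
   (the same outcome may be listed several times; its probability is then the
   sum of the weights). *)
Record dist (R : realType) (T : Type) := Dist {
  weights :> seq (R * T);
  weights_gt0 : all (fun p => 0 < p.1) weights;
  weights_sum1 : \sum_(p <- weights) p.1 = 1 }.

Definition Pr (R : realType) (T : Type) (d : dist R T) (A : pred T) : R :=
  \sum_(p <- weights d | A p.2) p.1.

Definition surely (R : realType) (T : Type) (d : dist R T) (A : pred T) : bool :=
  all (fun p => A p.2) (weights d).

Lemma dret_gt0 (R : realType) (T : Type) (x : T) :
  all (fun p : R * T => 0 < p.1) [:: (1, x)].
Proof. by rewrite /= ltr01. Qed.

Lemma dret_sum1 (R : realType) (T : Type) (x : T) :
  \sum_(p <- [:: (1 : R, x)]) p.1 = 1.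
Proof. by rewrite big_seq1. Qed.

Definition dret (R : realType) (T : Type) (x : T) : dist R T :=
  Dist (dret_gt0 R x) (dret_sum1 R x).

Definition bind_weights (R : realType) (T U : Type) (d : dist R T)
    (f : T -> dist R U) : seq (R * U) :=
  flatten [seq [seq (p.1 * q.1, q.2) | q <- weights (f p.2)] | p <- weights d].

Lemma dbind_gt0 (R : realType) (T U : Type) (d : dist R T) (f : T -> dist R U) :
  all (fun p => 0 < p.1) (bind_weights d f).
Proof.
rewrite /bind_weights; have := weights_gt0 d.
elim: (weights d) => //= p s IHs /andP[p0 s0].
rewrite all_cat IHs // andbT all_map; apply: sub_all (weights_gt0 (f p.2)) => q /=.
exact: mulr_gt0.
Qed.

Lemma dbind_sum1 (R : realType) (T U : Type) (d : dist R T) (f : T -> dist R U) :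
  \sum_(p <- bind_weights d f) p.1 = 1.
Proof.
rewrite /bind_weights big_flatten big_map -[RHS](weights_sum1 d).
by apply: eq_bigr => p _; rewrite big_map -mulr_sumr weights_sum1 mulr1.
Qed.

Definition dbind (R : realType) (T U : Type) (d : dist R T)
    (f : T -> dist R U) : dist R U :=
  Dist (dbind_gt0 d f) (dbind_sum1 d f).

Definition uniform_weights (R : realType) (T : Type) (x : T) (s : seq T) :
    seq (R * T) :=
  [seq ((size s).+1%:R^-1, y) | y <- x :: s].

Lemma uniform_gt0 (R : realType) (T : Type) (x : T) (s : seq T) :
  all (fun p => 0 < p.1) (uniform_weights R x s).
Proof. by rewrite all_map; apply/allT => y /=; rewrite invr_gt0 ltr0n. Qed.

Lemma uniform_sum1 (R : realType) (T : Type) (x : T) (s : seq T) :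
  \sum_(p <- uniform_weights R x s) p.1 = 1.
Proof.
rewrite big_map big_const_seq count_predT iter_addr_0 /=.
by rewrite -[_ *+ _]mulr_natl divff // pnatr_eq0.
Qed.

(* Uniform distribution on the positions of the nonempty list x :: s. *)
Definition duniform (R : realType) (T : Type) (x : T) (s : seq T) : dist R T :=
  Dist (uniform_gt0 R x s) (uniform_sum1 R x s).

(* A directed graph on V is a relation E : rel V; self-loops are allowed. *)

Definition num_edges (V : finType) (E : rel V) : nat :=
  #|[set e : V * V | E e.1 e.2]|.

Definition outdeg_set (V : finType) (E : rel V) (S : {set V}) : nat :=
  #|[set e : V * V | E e.1 e.2 & e.1 \in S]|.

Definition boundary (V : finType) (E : rel V) (S : {set V}) : {set V * V} :=
  [set e : V * V | [&& E e.1 e.2, e.1 \in S & e.2 \notin S]].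

(* If no edge leaves a node of S the quotient is 0 / 0, which is 0 here: such an
   S has conductance 0, like every set without outgoing boundary edge. *)
Definition conductance (R : realType) (V : finType) (E : rel V) (S : {set V}) : R :=
  #|boundary E S|%:R / (outdeg_set E S)%:R.

(* Since conductance E S <= 1 always, the unit 1 of the iterated minimum only
   matters when the range is empty. *)
Definition gen_conductance (R : realType) (V : finType) (E : rel V) (eps : R) : R :=
  \big[Num.min/1]_(S : {set V} |
      (0 < #|S|)%N && (#|S|%:R <= (1 - eps) * #|V|%:R)) conductance R E S.

Record oracle (V : finType) (E : rel V) (L : choiceType) := Oracle {
  label : V -> L;
  label_inj : injective label;
  adj : V -> seq V;
  adj_perm : forall u, perm_eq (adj u) (enum (E u));
  start : V }.

Inductive query (L : Type) : Type :=
| Init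
| Out of L & nat.
Arguments Init {L}.

(* The label of the reported node, and its out-degree. *)
Definition answer (L : Type) : Type := (L * nat)%type.

Definition transcript (L : Type) : Type := seq (query L * answer L).

Definition report (V : finType) (E : rel V) (L : choiceType)
    (O : oracle E L) (v : V) : answer L :=
  (label O v, size (adj O v)).

(* Answer to q after the exchange h; None for an inadmissible query, i.e. one
   about a node not revealed in h or with an index outside 1, ..., deg+(u). *)
Definition respond (V : finType) (E : rel V) (L : choiceType)
    (O : oracle E L) (h : transcript L) (q : query L) : option (answer L) :=
  match q with
  | Init => Some (report O (start O))
  | Out a i =>
      if [pick v | label O v == a] is Some u then
        if (a \in [seq t.2.1 | t <- h]) && (0 < i <= size (adj O u))%N
        then Some (report O (nth u (adj O u) i.-1))
        else None
      else None
  end.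

(* The initial query is not counted: with it, an execution disclosing every edge
   makes num_edges E + 1 queries. *)
Definition out_queries (L : Type) (h : transcript L) : nat :=
  count (fun t => if t.1 is Out _ _ then true else false) h.

(* The sets S (labels seen so far) and E' (undisclosed out-edge slots), with the
   exchange with the oracle so far. *)
Record state (L : choiceType) := State {
  seen : {fset L};
  slots : {fset L * nat};
  history : transcript L }.

Definition node_slots (L : choiceType) (a : answer L) : {fset L * nat} :=
  [fset (a.1, i) | i in iota 1 a.2].

(* One block of at most k steps; the boolean tells whether a new node was found.
   A block also ends, unsuccessfully, when E' is empty.  None stands for an
   inadmissible query. *)
Fixpoint block (R : realType) (V : finType) (E : rel V) (L : choiceType)
    (O : oracle E L) (k : nat) (s : state L) : dist R (option (bool * state L)) :=
  if k is k'.+1 then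
    if enum_fset (slots s) is e0 :: es then
      dbind (duniform R e0 es) (fun e =>
        let q := Out e.1 e.2 in
        if respond O (history s) q is Some a then
          let slots' := slots s `\ e in
          let history' := rcons (history s) (q, a) in
          if a.1 \in seen s then block R O k' (State (seen s) slots' history')
          else dret R (Some (true,
            State (a.1 |` seen s) (slots' `|` node_slots a) history'))
        else dret R None)
    else dret R (Some (false, s))
  else dret R (Some (false, s)).

(* The while loop, cut off after fuel iterations.  An outcome Some (nhat, h) is
   a halted execution with output nhat and exchange h; None stands for an
   execution that was cut off or made an inadmissible query. *)
Fixpoint main_loop (R : realType) (V : finType) (E : rel V) (L : choiceType)
    (O : oracle E L) (l : nat) (phi : R) (fuel : nat) (Y : int) (s : state L) :
    dist R (option (nat * transcript L)) :=
  if Y <= l%:Z then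
    if fuel is fuel'.+1 then
      dbind (block R O (Num.truncn (2 / phi)) s) (fun o =>
        if o is Some (found, s') then
          main_loop O l phi fuel' (if found then Y - 1 else Y + 1) s'
        else dret R None)
    else dret R None
  else dret R (Some (#|` seen s|, history s)).

Definition edge_sampling (R : realType) (V : finType) (E : rel V) (L : choiceType)
    (O : oracle E L) (l : nat) (phi : R) (fuel : nat) :
    dist R (option (nat * transcript L)) :=
  if respond O [::] Init is Some a then
    main_loop O l phi fuel 0 (State [fset a.1] (node_slots a) [:: (Init, a)])
  else dret R None.

Definition halted_with (L : choiceType) (A : nat -> transcript L -> bool)
    (o : option (nat * transcript L)) : bool :=
  if o is Some (nhat, h) then A nhat h else false.

(* Main.v *)
Require Import Defs.
From mathcomp Require Import all_boot all_order all_algebra.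
From mathcomp Require Import finmap reals boolp.
From mathcomp Require Import zify lra.

Set Implicit Arguments.
Unset Strict Implicit.
Unset Printing Implicit Defensive.

Import Order.TTheory GRing.Theory Num.Theory.
Local Open Scope fset_scope.
Local Open Scope ring_scope.

(** Every edge from a seen to an unseen node is still an undisclosed slot, and
    there are at most deg+(S) slots.  So while |S| <= (1 - eps) n each step
    finds a new node with probability at least phi, and by Bernoulli's
    inequality a block fails with probability at most
    (1 - phi)^floor(2/phi) <= 1/3.  Hence 2^(Y - l - 1) is a supermartingale
    until |S| is large, and the loop stops too early with probability at most
    2^(-l-1).  Halting and the query bound hold because
    2 (n - |S|) + (l + 1 - Y) decreases by one with each block: there are at
    most 2n + l - 1 blocks, and the missing one pays for the initial query. *)

Section Expectation.
Variable R : realType.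

Definition expect (T : Type) (d : dist R T) (g : T -> R) : R :=
  \sum_(p <- weights d) p.1 * g p.2.

Lemma sub_surely (T : Type) (d : dist R T) (A B : pred T) :
  subpred A B -> surely d A -> surely d B.
Proof. by move=> sAB; apply: sub_all => p; apply: sAB. Qed.

Lemma surely_predT (T : Type) (d : dist R T) : surely d predT.
Proof. exact: all_predT. Qed.

Lemma surely_dret (T : Type) (x : T) (A : pred T) : surely (dret R x) A = A x.
Proof. by rewrite /surely /= andbT. Qed.

Lemma surely_dbind (T U : Type) (d : dist R T) (f : T -> dist R U)
    (A : pred T) (B : pred U) :
  surely d A -> (forall x, A x -> surely (f x) B) -> surely (dbind d f) B.
Proof.
rewrite /surely /= /bind_weights => dA AB; elim: (weights d) dA => //= p s IHs.
by move=> /andP[Ap /IHs]; rewrite all_cat all_map AB.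
Qed.

Lemma surely_duniform (T : eqType) (x : T) (s : seq T) :
  surely (duniform R x s) (mem (x :: s)).
Proof. by rewrite /surely all_map; apply/allP. Qed.

Lemma expect_cst (T : Type) (d : dist R T) (a : R) : expect d (fun=> a) = a.
Proof. by rewrite /expect -mulr_suml weights_sum1 mul1r. Qed.

Lemma expect_le (T : Type) (d : dist R T) (A : pred T) (f g : T -> R) :
  surely d A -> (forall x, A x -> f x <= g x) -> expect d f <= expect d g.
Proof.
rewrite /surely /expect => + fg; have := weights_gt0 d.
elim: (weights d) => [|p s IHs] /=; first by rewrite !big_nil.
move=> /andP[p0 /IHs{}IHs] /andP[/fg fgp /IHs sfg]; rewrite !big_cons.
by rewrite lerD // ler_wpM2l // ltW.
Qed.

Lemma expect_if (T : Type) (d : dist R T) (C : pred T) (a b : R) :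
  expect d (fun x => if C x then a else b) = a * Pr d C + b * Pr d (predC C).
Proof.
rewrite /expect (bigID (fun p => C p.2)) /Pr !mulr_sumr /=.
by congr (_ + _); apply: eq_bigr => p; [move=> -> | move=> /negPf ->];
  rewrite mulrC.
Qed.

Lemma Pr_expect (T : Type) (d : dist R T) (A : pred T) :
  Pr d A = expect d (fun x => (A x)%:R).
Proof.
rewrite /Pr big_mkcond; apply: eq_bigr => p _.
by case: (A p.2); rewrite ?mulr1 ?mulr0.
Qed.

Lemma Pr_dbind (T U : Type) (d : dist R T) (f : T -> dist R U) (B : pred U) :
  Pr (dbind d f) B = expect d (fun x => Pr (f x) B).
Proof.
rewrite /Pr /expect /= /bind_weights big_flatten big_map.
by apply: eq_bigr => p _; rewrite big_map mulr_sumr.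
Qed.

Lemma Pr_dret (T : Type) (x : T) (A : pred T) : Pr (dret R x) A = (A x)%:R.
Proof. by rewrite Pr_expect /expect big_seq1 mul1r. Qed.

Lemma Pr_duniform (T : Type) (x : T) (s : seq T) (A : pred T) :
  Pr (duniform R x s) A = (count A (x :: s))%:R / (size (x :: s))%:R.
Proof. by rewrite /Pr big_map big_const_seq iter_addr_0 [RHS]mulr_natl. Qed.

Lemma Pr_predC (T : Type) (d : dist R T) (A : pred T) :
  Pr d (predC A) = 1 - Pr d A.
Proof.
by rewrite -(weights_sum1 d) (bigID (fun p => A p.2)) /= addrAC subrr add0r.
Qed.

Lemma Pr_le1 (T : Type) (d : dist R T) (A : pred T) : Pr d A <= 1.
Proof.
rewrite Pr_expect -[leRHS](expect_cst d).
apply: expect_le (surely_predT d) _ => x _.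
by case: (A x); rewrite ?ler01.
Qed.

Lemma surely_Pr1 (T : Type) (d : dist R T) (A : pred T) :
  surely d A -> Pr d A = 1.
Proof.
move=> dA; apply: le_anti; rewrite Pr_le1 Pr_expect -[leLHS](expect_cst d).
by apply: expect_le dA _ => x ->.
Qed.

(* A walk on y going up with probability at least 2/3 has 2^-y as a
   supermartingale. *)
Lemma expect_biased_walk (T : Type) (d : dist R T) (C : pred T) (y : nat) :
  Pr d (predC C) <= 3^-1 ->
  expect d (fun x => 2 ^- (if C x then y.+2 else y)) <= 2 ^- y.+1.
Proof.
move=> fail; have -> : expect d (fun x => 2 ^- (if C x then y.+2 else y)) =
    expect d (fun x => if C x then 2 ^- y.+2 else 2 ^- y).
  by apply: eq_bigr => p _; case: (C p.2).
have pow_ge0 : 0 <= 2 ^- y :> R by rewrite invr_ge0 exprn_ge0.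
rewrite expect_if; move: fail; rewrite Pr_predC !exprS !invfM => fail.
by have := ler_wpM2l pow_ge0 fail; lra.
Qed.

End Expectation.

Lemma exprn_one_sub_Bernoulli (R : realDomainType) (x : R) (n : nat) :
  0 <= x <= 1 -> (1 - x) ^+ n * (1 + n%:R * x) <= 1.
Proof.
move=> /andP[x0 x1]; elim: n => [|n IHn]; first by rewrite expr0 mul0r; lra.
have y0 : 0 <= 1 - x by rewrite subr_ge0.
have pow_le1 : (1 - x) ^+ n.+1 <= 1 by rewrite exprn_ile1 // gerBl.
have := ler_wpM2l y0 IHn; have := ler_wpM2r x0 pow_le1.
by rewrite exprS -natr1; lra.
Qed.

Lemma exprn_one_sub_le_third (R : realFieldType) (x : R) (k : nat) :
  0 <= x <= 1 -> 2 <= k.+1%:R * x -> (1 - x) ^+ k <= 3^-1.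
Proof.
move=> x01; have /andP[x0 x1] := x01; case: k => [|n]; first by lra.
rewrite -(addn2 n) natrD => nx; have y0 : 0 <= 1 - x by rewrite subr_ge0.
have := exprn_one_sub_Bernoulli n x01; rewrite exprSr.
have : 3 * (1 - x) <= 1 + n%:R * x by lra.
by move=> /(ler_wpM2l (exprn_ge0 n y0)); lra.
Qed.

Section BlockLength.
Variables (R : realType) (phi : R).
Hypotheses (phi_gt0 : 0 < phi) (phi_le1 : phi <= 1).

Definition block_length : nat := Num.truncn (2 / phi).

Lemma block_length_mul_le (b : nat) : (block_length * b)%:R <= 2 * b%:R / phi.
Proof.
by rewrite natrM mulrAC ler_wpM2r // truncn_le divr_ge0 // ltW.
Qed.

Lemma block_length_gt0 : (0 < block_length)%N.
Proof.
by rewrite truncn_gt0 ler_pdivlMr // mul1r (le_trans phi_le1) // ler1n.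
Qed.

Lemma exprn_block_length_le : (1 - phi) ^+ block_length <= 3^-1.
Proof.
apply: exprn_one_sub_le_third; first by rewrite ltW.
by rewrite -ler_pdivrMr // ltW // truncnS_gt.
Qed.

End BlockLength.

Section Graph.
Variables (V : finType) (E : rel V).

Lemma outdeg_set_sum (S : {set V}) :
  outdeg_set E S = (\sum_(u in S) #|E u|)%N.
Proof.
under eq_bigr => u _ do rewrite -sum1_card.
rewrite pair_big_dep /= sum1_card; apply: eq_card => e.
by rewrite !inE andbC.
Qed.

Lemma outdeg_setU1 (w : V) (S : {set V}) :
  w \notin S -> outdeg_set E (w |: S) = (#|E w| + outdeg_set E S)%N.
Proof. by move=> wS; rewrite !outdeg_set_sum big_setU1. Qed.

Lemma outdeg_set1 (w : V) : outdeg_set E [set w] = #|E w|.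
Proof. by rewrite outdeg_set_sum big_set1. Qed.

Lemma outdeg_set_le_num_edges (S : {set V}) : (outdeg_set E S <= num_edges E)%N.
Proof.
by apply: subset_leq_card; apply/subsetP => e; rewrite !inE => /andP[].
Qed.

Lemma boundary_le_outdeg (S : {set V}) : (#|boundary E S| <= outdeg_set E S)%N.
Proof.
by apply: subset_leq_card; apply/subsetP => e; rewrite !inE => /and3P[-> ->].
Qed.

Lemma conductance_le1 (R : realType) (S : {set V}) : conductance R E S <= 1.
Proof.
have := boundary_le_outdeg S; rewrite /conductance.
case: (outdeg_set E S) => [|d] Sd; first by rewrite invr0 mulr0.
by rewrite ler_pdivrMr // mul1r ler_nat.
Qed.

Lemma gen_conductance_le (R : realType) (eps : R) (S : {set V}) :
  (0 < #|S|)%N -> #|S|%:R <= (1 - eps) * #|V|%:R ->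
  gen_conductance E eps <= conductance R E S.
Proof. by move=> S0 SV; apply: bigmin_le_cond; rewrite S0. Qed.

End Graph.

Lemma in_node_slots (L : choiceType) (a : answer L) (e : L * nat) :
  (e \in node_slots a) = (e.1 == a.1) && (0 < e.2 <= a.2)%N.
Proof.
apply/imfsetP/idP => [[i /= ia ->]|/andP[/eqP e1 e2]] /=.
  by rewrite eqxx /=; move: ia; rewrite mem_iota; lia.
by exists e.2; rewrite /= ?mem_iota; [lia | rewrite -e1; case: e {e1 e2}].
Qed.

Lemma card_node_slots (L : choiceType) (a : answer L) : #|` node_slots a| = a.2.
Proof.
rewrite card_imfset => [|i j []//]; rewrite /= undup_id ?size_iota //.
exact: iota_uniq.
Qed.

Lemma out_queries_rcons (L : Type) (h : transcript L) (a b : L * nat) :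
  out_queries (rcons h (Out a.1 a.2, b)) = (out_queries h).+1.
Proof. by rewrite /out_queries -cats1 count_cat addn1. Qed.

Section Oracle.
Variables (V : finType) (E : rel V) (L : choiceType) (O : oracle E L).
Implicit Types (u v w : V) (e : L * nat).

Definition out_slots (u : V) : {fset L * nat} := node_slots (report O u).

Definition out_neighbor (u : V) (i : nat) : V := nth u (adj O u) i.-1.

Definition edge_slot (uw : V * V) : L * nat :=
  (label O uw.1, (index uw.2 (adj O uw.1)).+1).

Lemma card_nodes_gt0 : (0 < #|V|)%N.
Proof. by apply/card_gt0P; exists (start O). Qed.

Lemma mem_adj u w : (w \in adj O u) = E u w.
Proof. by rewrite (perm_mem (adj_perm O u)) mem_enum. Qed.

Lemma card_out_slots u : #|` out_slots u| = #|E u|.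
Proof. by rewrite card_node_slots /= (perm_size (adj_perm O u)) -cardE. Qed.

Lemma out_slots_inj u v e : e \in out_slots u -> e \in out_slots v -> u = v.
Proof.
rewrite !in_node_slots => /andP[/eqP -> _] /andP[/eqP uv _].
exact: label_inj uv.
Qed.

Lemma edge_slot_out_slots u w : E u w -> edge_slot (u, w) \in out_slots u.
Proof. by rewrite in_node_slots eqxx /= index_mem mem_adj. Qed.

Lemma out_neighbor_edge_slot u w :
  E u w -> out_neighbor u (edge_slot (u, w)).2 = w.
Proof. by move=> Euw; rewrite /out_neighbor nth_index // mem_adj. Qed.

Lemma edge_slot_inj :
  {in [set uw : V * V | E uw.1 uw.2] &, injective edge_slot}.
Proof.
move=> [u w] [v x]; rewrite !inE /= => Euw Evx eq_slot.
have uv : u = v.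
  apply: out_slots_inj (edge_slot_out_slots Euw) _.
  by rewrite eq_slot edge_slot_out_slots.
rewrite -{}uv in eq_slot Evx *; congr (_, _).
by rewrite -(out_neighbor_edge_slot Euw) eq_slot out_neighbor_edge_slot.
Qed.

Lemma respond_out (h : transcript L) u e :
  label O u \in [seq t.2.1 | t <- h] -> e \in out_slots u ->
  respond O h (Out e.1 e.2) = Some (report O (out_neighbor u e.2)).
Proof.
move=> uh; rewrite in_node_slots /respond => /andP[/eqP -> ue].
case: pickP => [v /eqP /label_inj ->|/(_ u)]; last by rewrite eqxx.
by rewrite uh ue.
Qed.

End Oracle.

Section Runs.
Variables (V : finType) (E : rel V) (L : choiceType) (O : oracle E L).
Implicit Types (u v w : V) (e f : L * nat) (s : state L).

Definition revealed (s : state L) : {set V} := [set v | label O v \in seen s].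

Definition init_state : state L :=
  let a := report O (start O) in State [fset a.1] (node_slots a) [:: (Init, a)].

Definition revisit (s : state L) (e : L * nat) (a : answer L) : state L :=
  State (seen s) (slots s `\ e) (rcons (history s) (Out e.1 e.2, a)).

Definition discover (s : state L) (e : L * nat) (a : answer L) : state L :=
  State (a.1 |` seen s) ((slots s `\ e) `|` node_slots a)
    (rcons (history s) (Out e.1 e.2, a)).

(* [slots_queries] makes every out-query consume a slot, so that no edge is
   disclosed twice; [removed_slots] says that every edge leaving the seen nodes
   is still available in E'. *)
Record consistent (s : state L) : Prop := Consistent {
  seen_labels : {subset seen s <= codom (label O)};
  seen_history : {subset seen s <= [seq t.2.1 | t <- history s]};
  slots_revealed : forall e, e \in slots s ->
    exists2 u, u \in revealed s & e \in out_slots O u;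
  removed_slots : forall u e, u \in revealed s -> e \in out_slots O u ->
    e \notin slots s -> out_neighbor O u e.2 \in revealed s;
  slots_queries :
    (#|` slots s| + out_queries (history s) = outdeg_set E (revealed s))%N;
  size_history : size (history s) = (out_queries (history s)).+1 }.

Lemma revealed_discover s e w :
  revealed (discover s e (report O w)) = w |: revealed s.
Proof.
by apply/setP => v; rewrite !inE (inj_eq (@label_inj _ _ _ O)).
Qed.

Lemma revealed_init : revealed init_state = [set start O].
Proof.
by apply/setP => v; rewrite !inE (inj_eq (@label_inj _ _ _ O)).
Qed.

Lemma consistent_init : consistent init_state.
Proof.
split.
- by move=> a; rewrite in_fset1 => /eqP ->; apply: codom_f.
- by move=> a; rewrite in_fset1 inE.
- by move=> e es; exists (start O); rewrite // revealed_init set11.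
- by move=> u e; rewrite revealed_init => /set1P -> ->.
- by rewrite revealed_init outdeg_set1 -(card_out_slots O) addn0.
- by [].
Qed.

Section Consistent.
Variable s : state L.
Hypothesis s_consistent : consistent s.

Lemma card_seen : #|` seen s| = #|revealed s|.
Proof.
have -> : seen s = [fset label O v | v in revealed s].
  apply/fsetP => a; apply/idP/imfsetP => [as_|[v /= + ->]]; last by rewrite inE.
  have /codomP[v av] := seen_labels s_consistent as_.
  by exists v; rewrite //= inE -av.
by rewrite card_imfset ?cardE //; apply: label_inj.
Qed.

Lemma card_seen_le : (#|` seen s| <= #|V|)%N.
Proof. by rewrite card_seen max_card. Qed.

Lemma card_slots_le : (#|` slots s| <= outdeg_set E (revealed s))%N.
Proof. by rewrite -(slots_queries s_consistent) leq_addr. Qed.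

Lemma out_queries_le : (out_queries (history s) <= num_edges E)%N.
Proof.
apply: leq_trans (outdeg_set_le_num_edges E (revealed s)).
by rewrite -(slots_queries s_consistent) leq_addl.
Qed.

Lemma respond_revealed u e :
  u \in revealed s -> e \in out_slots O u ->
  respond O (history s) (Out e.1 e.2) = Some (report O (out_neighbor O u e.2)).
Proof. by rewrite inE => /(seen_history s_consistent) /respond_out; apply. Qed.

Lemma slots_disjoint w :
  w \notin revealed s -> [disjoint slots s & out_slots O w].
Proof.
move=> ws; apply/fdisjointP => e /(slots_revealed s_consistent)[u us eu].
by apply: contra ws => /(out_slots_inj eu) <-.
Qed.

Section Query.
Variables (u : V) (e : L * nat).
Hypotheses (e_slot : e \in slots s) (eu : e \in out_slots O u).
Let w : V := out_neighbor O u e.2.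

Lemma removed_slotsD1 v f :
  v \in revealed s -> f \in out_slots O v -> f \notin (slots s `\ e) ->
  out_neighbor O v f.2 \in w |: revealed s.
Proof.
move=> vs fv; rewrite in_fsetD1 negb_and negbK => /predU1P[fe|fs].
  by rewrite fe in fv *; rewrite -(out_slots_inj eu fv) setU11.
by rewrite setU1r // (removed_slots s_consistent).
Qed.

Lemma slots_queriesD1 :
  (#|` slots s `\ e| + (out_queries (history s)).+1 =
    outdeg_set E (revealed s))%N.
Proof.
by rewrite -(slots_queries s_consistent) (cardfsD1 e (slots s)) e_slot addnS.
Qed.

Lemma seen_history_rcons : {subset seen s <=
  [seq t.2.1 | t <- rcons (history s) (Out e.1 e.2, report O w)]}.
Proof.
move=> a /(seen_history s_consistent).
by rewrite map_rcons mem_rcons inE orbC => ->.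
Qed.

Lemma consistent_revisit :
  w \in revealed s -> consistent (revisit s e (report O w)).
Proof.
move=> ws; split.
- exact: (seen_labels s_consistent).
- exact: seen_history_rcons.
- move=> f; rewrite in_fsetD1 => /andP[_].
  exact: (slots_revealed s_consistent).
- move=> v f vs fv /(removed_slotsD1 vs fv).
  by rewrite (setUidPr _) // sub1set.
- by rewrite out_queries_rcons slots_queriesD1.
- by rewrite size_rcons out_queries_rcons (size_history s_consistent).
Qed.

Lemma consistent_discover :
  w \notin revealed s -> consistent (discover s e (report O w)).
Proof.
move=> ws; split; rewrite ?revealed_discover.
- move=> a; rewrite in_fset1U => /predU1P[->|]; first exact: codom_f.
  exact: (seen_labels s_consistent).
- move=> a; rewrite in_fset1U => /predU1P[->|]; last exact: seen_history_rcons.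
  by rewrite map_rcons mem_rcons mem_head.
- move=> f; rewrite in_fsetU in_fsetD1 => /orP[/andP[_ fs]|fw].
    have [v vs fv] := slots_revealed s_consistent fs.
    by exists v; rewrite ?revealed_discover ?setU1r.
  by exists w; rewrite ?revealed_discover ?setU11.
- move=> v f vws fv; rewrite in_fsetU negb_or => /andP[fs fw].
  case/setU1P: vws => [vw|vs]; last exact: removed_slotsD1.
  by move: fw; rewrite -vw fv.
- rewrite outdeg_setU1 // -slots_queriesD1 out_queries_rcons.
  rewrite -(card_out_slots O) addnCA addnA; congr (_ + _)%N.
  have /fdisjointWl dis := slots_disjoint ws.
  by apply/eqP; rewrite (leq_card_fsetU _ _).2 dis // fsubD1set.
- by rewrite size_rcons out_queries_rcons (size_history s_consistent).
Qed.

End Query.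

End Consistent.

Definition reveals (s : state L) (e : L * nat) : bool :=
  if respond O (history s) (Out e.1 e.2) is Some a then a.1 \notin seen s
  else false.

Lemma boundary_le_reveals s :
  consistent s -> (#|boundary E (revealed s)| <= count (reveals s) (slots s))%N.
Proof.
move=> cs; rewrite -size_filter cardE -(size_map (edge_slot O)).
apply: uniq_leq_size.
  rewrite map_inj_in_uniq ?enum_uniq // => uw vx.
  rewrite !mem_enum !inE => /andP[Euw _] /andP[Evx _].
  by apply: (edge_slot_inj (O := O)); rewrite inE.
move=> _ /mapP[[u w] + ->]; rewrite mem_enum inE /= => /and3P[Euw us nw].
have slot_u := edge_slot_out_slots O Euw.
rewrite mem_filter /reveals (respond_revealed cs us slot_u).
rewrite out_neighbor_edge_slot //=; apply/andP.
split; first by rewrite inE in nw.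
apply: contraNT nw => /(removed_slots cs us slot_u).
by rewrite out_neighbor_edge_slot.
Qed.

Lemma conductance_le_Pr_reveals (R : realType) s e es :
  consistent s -> enum_fset (slots s) = e :: es ->
  conductance R E (revealed s) <= Pr (duniform R e es) (reveals s).
Proof.
move=> cs slotsE; have bound := boundary_le_reveals cs.
have slots_le := card_slots_le cs; rewrite slotsE in bound slots_le.
rewrite Pr_duniform; apply: ler_pM; rewrite ?invr_ge0 ?ler_nat //.
by rewrite lef_pV2 ?posrE ?ltr0n ?ler_nat // (leq_trans _ slots_le).
Qed.

Record reaches (q : nat) (s s' : state L) : Prop := Reaches {
  reaches_consistent : consistent s';
  reaches_seen : seen s `<=` seen s';
  reaches_queries :
    (out_queries (history s') <= out_queries (history s) + q)%N }.

Lemma reaches_refl q s : consistent s -> reaches q s s.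
Proof. by move=> cs; split; rewrite ?leq_addr. Qed.

Lemma reaches_trans q q' s s' s'' :
  reaches q s s' -> reaches q' s' s'' -> reaches (q + q') s s''.
Proof.
move=> [_ ss' qs'] [cs'' ss'' qs'']; split=> //.
  exact: fsubset_trans ss''.
by rewrite (leq_trans qs'') // addnA leq_add2r.
Qed.

Lemma leq_reaches q q' s s' : (q <= q')%N -> reaches q s s' -> reaches q' s s'.
Proof.
by move=> qq' [cs' ss' qs']; split; rewrite // (leq_trans qs') ?leq_add2l.
Qed.

Section Block.
Variable R : realType.

Definition block_step (k : nat) (s : state L) (e : L * nat) :
    dist R (option (bool * state L)) :=
  if respond O (history s) (Out e.1 e.2) is Some a then
    if a.1 \in seen s then block R O k (revisit s e a)
    else dret R (Some (true, discover s e a))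
  else dret R None.

Lemma blockS k s :
  block R O k.+1 s =
    if enum_fset (slots s) is e :: es then
      dbind (duniform R e es) (block_step k s)
    else dret R (Some (false, s)).
Proof. by []. Qed.

Variant block_step_spec (k : nat) (s : state L) :
    bool -> dist R (option (bool * state L)) -> Prop :=
| StepRevisit s' of reaches 1 s s' & seen s' = seen s :
    block_step_spec k s false (block R O k s')
| StepDiscover s' of reaches 1 s s' & #|` seen s'| = #|` seen s|.+1 :
    block_step_spec k s true (dret R (Some (true, s'))).

Lemma block_stepP k s e :
  consistent s -> e \in slots s ->
  block_step_spec k s (reveals s e) (block_step k s e).
Proof.
move=> cs es; have [u us eu] := slots_revealed cs es.
rewrite /reveals /block_step (respond_revealed cs us eu).
case: ifPn => ws; constructor => //.
- split=> //; first by apply: consistent_revisit; rewrite ?inE.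
  by rewrite out_queries_rcons addn1.
- split; first by apply: consistent_discover; rewrite ?inE.
    exact: fsubsetU1.
  by rewrite out_queries_rcons addn1.
- by rewrite cardfsU1 ws.
Qed.

Definition block_outcome (k : nat) (s : state L)
    (o : option (bool * state L)) : bool :=
  if o is Some (found, s') then
    `[< reaches k s s' >] && (#|` seen s'| == #|` seen s| + found)%N
  else false.

Lemma block_surely k s :
  consistent s -> surely (block R O k s) (block_outcome k s).
Proof.
have idle q s' : consistent s' ->
    surely (dret R (Some (false, s'))) (block_outcome q s').
  move=> cs'; rewrite surely_dret /= addn0 eqxx andbT.
  by apply/asboolP/reaches_refl.
elim: k s => [|k IHk] s cs; first exact: idle.
rewrite blockS; case slotsE: (enum_fset (slots s)) => [|e0 es].
  exact: idle.
apply: surely_dbind (surely_duniform R e0 es) _ => e; rewrite -slotsE => e_slot.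
case: (block_stepP k cs e_slot) => s' ss' seenE.
  apply: sub_surely (IHk _ (reaches_consistent ss')) => -[[found s'']|] //=.
  rewrite seenE => /andP[/asboolP s's'' ->]; rewrite andbT; apply/asboolP.
  by rewrite -add1n; apply: reaches_trans s's''.
rewrite surely_dret /= seenE addn1 eqxx andbT; apply/asboolP.
exact: leq_reaches ss'.
Qed.

Definition found_new (o : option (bool * state L)) : bool :=
  if o is Some (found, _) then found else false.

Lemma block_fail_prob k s :
  consistent s ->
  Pr (block R O k s) (predC found_new) <=
    (1 - conductance R E (revealed s)) ^+ k.
Proof.
elim: k s => [|k IHk] s cs; first by rewrite expr0 Pr_le1.
set c := conductance R E (revealed s).
have c_le1 : 0 <= 1 - c by rewrite subr_ge0 conductance_le1.
rewrite blockS; case slotsE: (enum_fset (slots s)) => [|e0 es].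
  have := boundary_le_reveals cs; rewrite slotsE leqn0 => /eqP no_boundary.
  by rewrite /c /conductance no_boundary mul0r subr0 expr1n Pr_le1.
pose fail_bound e := if reveals s e then 0 else (1 - c) ^+ k.
rewrite Pr_dbind; apply: (@le_trans _ _ (expect (duniform R e0 es) fail_bound)).
  apply: expect_le (surely_duniform R e0 es) _ => e.
  rewrite -slotsE /fail_bound => e_slot.
  case: (block_stepP k cs e_slot) => s' ss' seenE; last by rewrite Pr_dret.
  have -> : c = conductance R E (revealed s') by rewrite /revealed seenE.
  exact: IHk (reaches_consistent ss').
rewrite expect_if mul0r add0r Pr_predC exprSr ler_wpM2l ?exprn_ge0 //.
by rewrite lerD2l lerN2 conductance_le_Pr_reveals.
Qed.

End Block.

Section MainLoop.
Variables (R : realType) (l : nat) (phi : R).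

(* The main loop when [y] further net failures are needed to leave it. *)
Definition countdown_loop (fuel y : nat) (s : state L) :
    dist R (option (nat * transcript L)) :=
  main_loop O l phi fuel (l.+1%:Z - y%:Z) s.

Lemma countdown_loop0 fuel s :
  countdown_loop fuel 0 s = dret R (Some (#|` seen s|, history s)).
Proof.
by rewrite /countdown_loop; case: fuel => [|fuel] /=; rewrite ifF //; lia.
Qed.

Lemma countdown_loopS fuel y s :
  countdown_loop fuel.+1 y.+1 s =
    dbind (block R O (block_length phi) s) (fun o =>
      if o is Some (found, s') then
        countdown_loop fuel (if found then y.+2 else y) s'
      else dret R None).
Proof.
rewrite /countdown_loop /= ifT; last by lia.
congr dbind; apply/funext => -[[found s']|] //.
by congr (main_loop _ _ _ _ _ _); case: found; lia.
Qed.

Definition blocks_left (s : state L) (y : nat) : nat :=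
  (2 * (#|V| - #|` seen s|) + y)%N.

Lemma blocks_left_decr (found : bool) s s' y :
  consistent s' -> #|` seen s'| = (#|` seen s| + found)%N ->
  (blocks_left s' (if found then y.+2 else y) < blocks_left s y.+1)%N.
Proof.
by move=> /card_seen_le; rewrite /blocks_left; case: found => /=; lia.
Qed.

Definition loop_outcome (q : nat) (s : state L) (nhat : nat)
    (h : transcript L) : bool :=
  `[< exists s', [/\ reaches q s s', nhat = #|` seen s'| & h = history s'] >].

Lemma countdown_loop_surely fuel y s :
  consistent s -> (blocks_left s y <= fuel)%N ->
  surely (countdown_loop fuel y s)
    (halted_with (loop_outcome (block_length phi * blocks_left s y) s)).
Proof.
have stop fuel' q s' : consistent s' ->
    surely (countdown_loop fuel' 0 s') (halted_with (loop_outcome q s')).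
  move=> cs'; rewrite countdown_loop0 surely_dret; apply/asboolP; exists s'.
  by split=> //; apply: reaches_refl.
elim: fuel y s => [|fuel IHf] [|y] s cs fuel_ge; try exact: stop.
  by move: fuel_ge; rewrite /blocks_left addnS.
rewrite countdown_loopS.
apply: surely_dbind (block_surely R _ cs) _ => -[[found s']|] //=.
case/andP=> /asboolP ss' /eqP seenE; have cs' := reaches_consistent ss'.
have decr := blocks_left_decr y cs' seenE.
apply: sub_surely (IHf _ _ cs' _); last by rewrite -ltnS (leq_trans decr).
case=> // -[nhat h] /asboolP[s'' [s's'' nhatE hE]]; apply/asboolP; exists s''.
split=> //; apply: leq_reaches (reaches_trans ss' s's'').
by rewrite -mulnS leq_mul2l decr orbT.
Qed.

Definition undershoots (eps : R) : pred (option (nat * transcript L)) :=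
  predC (halted_with (fun nhat _ => (1 - eps) * #|V|%:R <= nhat%:R)).

Lemma Pr_undershoots_eq0 (eps : R) fuel y s :
  consistent s -> (blocks_left s y <= fuel)%N ->
  (1 - eps) * #|V|%:R <= #|` seen s|%:R ->
  Pr (countdown_loop fuel y s) (undershoots eps) = 0.
Proof.
move=> cs fuel_ge many; rewrite Pr_predC surely_Pr1 ?subrr //.
apply: sub_surely (countdown_loop_surely cs fuel_ge) => -[[nhat h]|] //=.
move=> /asboolP[s' [ss' -> _]]; rewrite (le_trans many) // ler_nat.
exact/fsubset_leq_card/reaches_seen/ss'.
Qed.

Hypotheses (phi_gt0 : 0 < phi) (phi_le1 : phi <= 1).

Lemma block_length_fail_prob (eps : R) s :
  phi <= gen_conductance E eps -> consistent s -> (0 < #|` seen s|)%N ->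
  #|` seen s|%:R <= (1 - eps) * #|V|%:R ->
  Pr (block R O (block_length phi) s) (predC found_new) <= 3^-1.
Proof.
move=> phi_le cs s_gt0 few.
apply: le_trans (block_fail_prob _ _ cs) _.
apply: le_trans (exprn_block_length_le phi_gt0 phi_le1).
rewrite lerXn2r ?nnegrE ?subr_ge0 ?conductance_le1 // lerD2l lerN2.
by rewrite (le_trans phi_le) // gen_conductance_le // -card_seen.
Qed.

Lemma Pr_undershoots_le (eps : R) fuel y s :
  phi <= gen_conductance E eps -> consistent s -> (0 < #|` seen s|)%N ->
  (blocks_left s y <= fuel)%N ->
  Pr (countdown_loop fuel y s) (undershoots eps) <= 2 ^- y.
Proof.
move=> phi_le; elim: fuel y s => [|fuel IHf] [|y] s cs s_gt0 fuel_ge;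
  try by rewrite expr0 invr1 Pr_le1.
  by move: fuel_ge; rewrite /blocks_left addnS.
have [many|few] := leP ((1 - eps) * #|V|%:R) #|` seen s|%:R.
  by rewrite (Pr_undershoots_eq0 cs fuel_ge many) invr_ge0 exprn_ge0.
have fail := block_length_fail_prob phi_le cs s_gt0 (ltW few).
rewrite countdown_loopS Pr_dbind; apply: le_trans (expect_biased_walk y fail).
apply: expect_le (block_surely R _ cs) _ => -[[found s']|] //=.
case/andP=> /asboolP ss' /eqP seenE; have cs' := reaches_consistent ss'.
apply: IHf => //; first by rewrite seenE ltn_addr.
by rewrite -ltnS (leq_trans (blocks_left_decr y cs' seenE)).
Qed.

Lemma edge_samplingE fuel :
  edge_sampling O l phi fuel = countdown_loop fuel l.+1 init_state.
Proof. by rewrite /countdown_loop subrr. Qed.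

Lemma blocks_left_init :
  blocks_left init_state l.+1 = (2 * #|V| + l).-1.
Proof.
by have := card_nodes_gt0 O; rewrite /blocks_left cardfs1; lia.
Qed.

Lemma edge_sampling_surely fuel :
  (2 * #|V| + l <= fuel)%N ->
  surely (edge_sampling O l phi fuel) (halted_with (fun nhat h =>
    [&& (nhat <= #|V|)%N, (out_queries h <= num_edges E)%N &
        (size h <= block_length phi * (2 * #|V| + l))%N])).
Proof.
move=> fuel_ge; have init_le : (blocks_left init_state l.+1 <= fuel)%N.
  by rewrite blocks_left_init (leq_trans (leq_pred _)).
rewrite edge_samplingE.
apply: sub_surely (countdown_loop_surely consistent_init init_le).
case=> // -[nhat h] /asboolP[s [[cs _ q_le] -> ->]] /=.
rewrite card_seen_le // out_queries_le // size_history //.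
have -> : (2 * #|V| + l = (2 * #|V| + l).-1.+1)%N.
  by have := card_nodes_gt0 O; lia.
by rewrite mulnS -add1n leq_add ?block_length_gt0 // -blocks_left_init.
Qed.

Lemma Pr_edge_sampling_ge (eps : R) fuel :
  (2 * #|V| + l <= fuel)%N -> phi <= gen_conductance E eps ->
  1 - 2 ^- l.+1 <= Pr (edge_sampling O l phi fuel)
    (halted_with (fun nhat _ => (1 - eps) * #|V|%:R <= nhat%:R)).
Proof.
move=> fuel_ge phi_le; rewrite edge_samplingE lerBlDr -lerBlDl -Pr_predC.
apply: Pr_undershoots_le => //; first exact: consistent_init.
  by rewrite cardfs1.
by rewrite blocks_left_init (leq_trans (leq_pred _)).
Qed.

End MainLoop.
End Runs.

Theorem theorem5 (R : realType) (V : finType) (E : rel V) (L : choiceType)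
    (O : oracle E L) (l : nat) (phi : R) (hphi0 : 0 < phi) (hphi1 : phi <= 1) :
  exists N : nat, forall fuel : nat, (N <= fuel)%N ->
    let run := edge_sampling O l phi fuel in
    [/\ surely run (halted_with (fun _ h =>
          (out_queries h)%:R <=
            Num.min (2 * (2 * #|V|%:R + l%:R) / phi) (num_edges E)%:R)),
        surely run (halted_with (fun _ h =>
          (size h)%:R <= 2 * (2 * #|V|%:R + l%:R) / phi)),
        surely run (halted_with (fun nhat _ => (nhat <= #|V|)%N))
      & forall eps : R, 0 < eps -> phi <= gen_conductance E eps ->
          1 - 2 ^- l <=
            Pr run (halted_with (fun nhat _ => (1 - eps) * #|V|%:R <= nhat%:R))].
Proof.
exists (2 * #|V| + l)%N => fuel fuel_ge run.
have bounds := edge_sampling_surely O hphi0 hphi1 fuel_ge.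
have size_bound (h : transcript L) :
    (size h <= block_length phi * (2 * #|V| + l))%N ->
    (size h)%:R <= 2 * (2 * #|V|%:R + l%:R) / phi.
  rewrite -natrM -natrD -(ler_nat R) => /le_trans; apply.
  exact: block_length_mul_le.
split.
- apply: sub_surely bounds => -[[nhat h]|] //= /and3P[_ edges_ge /size_bound].
  rewrite le_min ler_nat edges_ge andbT; apply: le_trans.
  by rewrite ler_nat count_size.
- by apply: sub_surely bounds => -[[nhat h]|] //= /and3P[_ _ /size_bound].
- by apply: sub_surely bounds => -[[nhat h]|] //= /and3P[].
move=> eps _ /(Pr_edge_sampling_ge O hphi0 hphi1 fuel_ge); apply: le_trans.
by rewrite lerD2l lerN2 lef_pV2 ?posrE ?exprn_gt0 // ler_eXn2l ?ltr1n.
Qed.
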